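(* Let $(M,\eta,\mu)$ be a monad on $\mathbf{Sets}$, $A$ a set of labels, $O$ a set, $a\colon MO\to O$ an Eilenberg–Moore $M$-algebra, and $c=\langle o,t\rangle\colon X\to O\times(MX)^A$. Let $[\![\cdot]\!]\colon MX\to O^{A^*}$ be the semantic map of $c$ with respect to $a$. (1) (Transitions) Let $(\hat M,\hat\eta,\hat\mu)$ be a monad, $\sigma\colon M\Rightarrow\hat M$ a monad map, and $\hat a\colon\hat MO\to O$ an $\hat M$-algebra with $a=\hat a\circ\sigma_O$. Let $\hat c=\langle o,\sigma_X^A\circ t\rangle\colon X\to O\times(\hat MX)^A$ and let $\widehat{[\![\cdot]\!]}\colon\hat MX\to O^{A^*}$ be its semantic map with respect to $\hat a$. Then $[\![\cdot]\!]\circ\eta_X=\widehat{[\![\cdot]\!]}\circ\hat\eta_X$. (2) (Observations) Let $\hat a\colon M\hat O\to\hat O$ be an $M$-algebra and $h\colon(O,a)\to(\hat O,\hat a)$ an $M$-algebra homomorphism. Let $\hat c=\langle h\circ o,t\rangle\colon X\to\hat O\times(MX)^A$ and $\widehat{[\![\cdot]\!]}\colon MX\to\hat O^{A^*}$ its semantic map with respect to $\hat a$. Then $\widehat{[\![\cdot]\!]}=h^{A^*}\circ[\![\cdot]\!]$, where $h^{A^*}(\varphi)=h\circ\varphi$.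
   Context: An Eilenberg–Moore algebra for a monad $(M,\eta,\mu)$ is a map $a\colon MO\to O$ with $a\circ\eta_O=\mathrm{id}_O$ and $a\circ Ma=a\circ\mu_O$; a homomorphism $h\colon(O,a)\to(\hat O,\hat a)$ is a map with $h\circ a=\hat a\circ Mh$. A monad map $\sigma\colon M\Rightarrow\hat M$ is a natural transformation with $\sigma\circ\eta=\hat\eta$ and $\sigma\circ\mu=\hat\mu\circ\hat M\sigma\circ\sigma_M$. Given $c=\langle o,t\rangle\colon X\to O\times(MX)^A$ and an $M$-algebra $a\colon MO\to O$, the determinisation is $\langle o^\sharp,t^\sharp\rangle\colon MX\to O\times(MX)^A$ with $o^\sharp=a\circ Mo$ and $t^\sharp(m)(\ell)=\mu_X\big(M(\mathrm{ev}_\ell\circ t)(m)\big)$ for $\ell\in A$, where $\mathrm{ev}_\ell(g)=g(\ell)$. The semantic map $[\![\cdot]\!]\colon MX\to O^{A^*}$ is defined by $[\![m]\!](\varepsilon)=o^\sharp(m)$ and $[\![m]\!](\ell w)=[\![t^\sharp(m)(\ell)]\!](w)$ for $\ell\in A$, $w\in A^*$. *)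

(* Defs.v *)
From mathcomp Require Import all_boot.

Set Implicit Arguments.
Unset Strict Implicit.
Unset Printing Implicit Defensive.

(* The category of sets is rendered by types and functions. Equations between
   maps are Leibniz equalities of functions, so that, as in Sets, they are
   meant to be used together with functional extensionality. *)

Record monad := Monad {
  mobj :> Type -> Type;
  mfmap : forall S T : Type, (S -> T) -> mobj S -> mobj T;
  meta : forall S : Type, S -> mobj S;
  mmu : forall S : Type, mobj (mobj S) -> mobj S;
  mfmap_id : forall S : Type, mfmap (@id S) = @id (mobj S);
  mfmap_comp : forall (S T U : Type) (g : T -> U) (f : S -> T),
    mfmap (g \o f) = mfmap g \o mfmap f;
  meta_nat : forall (S T : Type) (f : S -> T),
    mfmap f \o @meta S = @meta T \o f;
  mmu_nat : forall (S T : Type) (f : S -> T),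
    mfmap f \o @mmu S = @mmu T \o mfmap (mfmap f);
  mmu_etal : forall S : Type, @mmu S \o @meta (mobj S) = @id (mobj S);
  mmu_etar : forall S : Type, @mmu S \o mfmap (@meta S) = @id (mobj S);
  mmu_assoc : forall S : Type,
    @mmu S \o @mmu (mobj S) = @mmu S \o mfmap (@mmu S)
}.

Arguments mfmap M {S T} f : rename.
Arguments meta M S : clear implicits, rename.
Arguments mmu M S : clear implicits, rename.

Record monad_map (M N : monad) := MonadMap {
  mmap_fun :> forall S : Type, M S -> N S;
  mmap_nat : forall (S T : Type) (f : S -> T),
    mfmap N f \o @mmap_fun S = @mmap_fun T \o mfmap M f;
  mmap_eta : forall S : Type, @mmap_fun S \o meta M S = meta N S;
  mmap_mu : forall S : Type,
    @mmap_fun S \o mmu M S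
      = mmu N S \o mfmap N (@mmap_fun S) \o @mmap_fun (M S)
}.

Arguments mmap_fun {M N} sigma S _ : rename.

Definition is_em_algebra (M : monad) (O : Type) (a : M O -> O) : Prop :=
  a \o meta M O = id /\ a \o mfmap M a = a \o mmu M O.

Definition is_em_hom (M : monad) (O P : Type) (a : M O -> O) (b : M P -> P)
    (h : O -> P) : Prop :=
  h \o a = b \o mfmap M h.

(* The map f^A : S^A -> T^A. *)
Definition powf (A S T : Type) (f : S -> T) : (A -> S) -> (A -> T) :=
  fun phi => f \o phi.

(* The map <f, g> : X -> S * T. *)
Definition tupling (X S T : Type) (f : X -> S) (g : X -> T) : X -> S * T :=
  fun x => (f x, g x).

Definition ev (A S : Type) (l : A) (g : A -> S) : S := g l.

Section Determinisation.

Variables (M : monad) (A O X : Type) (a : M O -> O).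
Variable c : X -> O * (A -> M X).

Definition det_obs : M X -> O := a \o mfmap M (fst \o c).

Definition det_trans : M X -> A -> M X :=
  fun m l => mmu M X (mfmap M (ev l \o (snd \o c)) m).

Definition determinisation : M X -> O * (A -> M X) :=
  tupling det_obs det_trans.

Fixpoint sem_word (w : seq A) (m : M X) : O :=
  match w with
  | [::] => (determinisation m).1
  | l :: w' => sem_word w' ((determinisation m).2 l)
  end.

Definition semantic_map : M X -> seq A -> O := fun m w => sem_word w m.

End Determinisation.

(* Main.v *)
(* Both parts follow by induction on the word, for all states of the
   determinisation at once. For transitions, sigma_X commutes with the two
   determinised transition maps and the two determinised observation maps agree
   along it, so the semantics agree along sigma_X, which sends unit to unit. For
   observations, the determinised transition map does not depend on the algebra,
   and the determinised observation map is postcomposed with h. *)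
Require Import Defs.
From mathcomp Require Import all_boot.
From Stdlib Require Import FunctionalExtensionality.

Lemma det_obs_monad_map (M N : monad) (sigma : monad_map M N) (A O X : Type)
    (b : N O -> O) (o : X -> O) (t : X -> A -> M X) (m : M X) :
  det_obs b (tupling o (powf (sigma X) \o t)) (sigma X m)
    = det_obs (b \o sigma O) (tupling o t) m.
Proof. exact (congr1 b (equal_f (mmap_nat sigma o) m)). Qed.

(** [mmap_mu] moves [sigma] inside the multiplication, naturality moves it past [ev l \o t], and
    functoriality of [N] fuses the two mapped functions. *)
Lemma det_trans_monad_map (M N : monad) (sigma : monad_map M N) (A O X : Type)
    (o : X -> O) (t : X -> A -> M X) (m : M X) (l : A) :
  det_trans (tupling o (powf (sigma X) \o t)) (sigma X m) l
    = sigma X (det_trans (tupling o t) m l).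
Proof.
pose f : X -> M X := ev l \o t.
have muE := equal_f (mmap_mu sigma X) (mfmap M f m).
have natE := equal_f (mmap_nat sigma f) m.
have compE := equal_f (mfmap_comp N (sigma X) f) (sigma X m).
rewrite /= in muE natE compE.
by rewrite /det_trans -[mfmap M _ m]/(mfmap M f m) muE -natE -compE.
Qed.

Lemma semantic_map_monad_map (M N : monad) (sigma : monad_map M N)
    (A O X : Type) (b : N O -> O) (o : X -> O) (t : X -> A -> M X) :
  semantic_map b (tupling o (powf (sigma X) \o t)) \o sigma X
    = semantic_map (b \o sigma O) (tupling o t).
Proof.
apply: functional_extensionality => m; apply: functional_extensionality => w.
rewrite /semantic_map /=.
elim: w m => [|l w IHw] m /=; first exact: det_obs_monad_map.
by rewrite det_trans_monad_map IHw.
Qed.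

Lemma semantic_map_em_hom (M : monad) (A O P X : Type) (a : M O -> O)
    (b : M P -> P) (h : O -> P) (o : X -> O) (t : X -> A -> M X) :
  is_em_hom a b h ->
  semantic_map b (tupling (h \o o) t) = powf h \o semantic_map a (tupling o t).
Proof.
move=> hom_h.
apply: functional_extensionality => m; apply: functional_extensionality => w.
rewrite /semantic_map /powf /=.
(* Both successor states are convertible, as they only read [t]; the homomorphism law enters at the
   empty word alone. *)
elim: w m => [|l w IHw] m /=; last exact: IHw.
have compE := equal_f (mfmap_comp M h o) m.
have homE := equal_f hom_h (mfmap M o m).
exact (etrans (congr1 b compE) (esym homE)).
Qed.

Theorem theorem6p7 (M : monad) (A O X : Type) (a : M O -> O)
    (ha : is_em_algebra a) (o : X -> O) (t : X -> A -> M X) :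
  (* transitions *)
  (forall (N : monad) (sigma : monad_map M N) (b : N O -> O),
      is_em_algebra b ->
      a = b \o sigma O ->
      semantic_map a (tupling o t) \o meta M X
        = semantic_map b (tupling o (powf (sigma X) \o t)) \o meta N X)
  /\
  (* observations *)
  (forall (P : Type) (b : M P -> P) (h : O -> P),
      is_em_algebra b ->
      is_em_hom a b h ->
      semantic_map b (tupling (h \o o) t)
        = powf h \o semantic_map a (tupling o t)).
Proof.
split=> [N sigma b _ -> | P b h _ hom_h]; last exact: semantic_map_em_hom.
(* Both sides become the semantics for [b] after [sigma X \o meta M X]. *)
by rewrite -(semantic_map_monad_map _ _ sigma) -(mmap_eta sigma).
Qed.
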